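(* Let $G$ be an infinite countable group with identity $\mathbf{i}$, and let $\mu$ be a $G$-invariant ergodic probability measure on $\{0,1\}^G$ with $p=\mu(\Gamma(\mathbf{i})=1)\in(0,1)$, where $\Gamma$ has law $\mu$. Let $\Theta$ be a transport rule for $\mu$ and let $X$ be a $G$-valued random variable on some joint probability space with $\Gamma$, and suppose that $X$ and $\Theta$ are related by $$\Theta_\Gamma(\mathbf{i},x)=\mathbf{P}(X=x\mid\Gamma)$$ for $\mu$-almost-all $\Gamma$ and all $x\in G$. Then $X$ is an extra head scheme for $\mu$ if and only if $\Theta$ is balanced.
   Context: $\{0,1\}^G$ carries the product $\sigma$-algebra. Elements of $G$ are called sites and elements of $\{0,1\}^G$ configurations. A group element $g$ acts on sites by $x\mapsto gx$ and on configurations by $(g\gamma)(x)=\gamma(g^{-1}x)$; invariance and ergodicity of $\mu$ are with respect to this action. $\mu^*(\cdot)=\mu(\Gamma\in\cdot\mid\Gamma(\mathbf{i})=1)$. A $G$-valued random variable $X$ on some joint probability space with $\Gamma$ is an extra head scheme for $\mu$ if $X^{-1}\Gamma$ has law $\mu^*$. A transport rule for $\mu$ is a measurable function $\Theta$ which assigns to $\mu$-almost-every configuration $\gamma$ and every pair of sites $x,y$ a nonnegative real number $\Theta_\gamma(x,y)$ such that, writing $\Theta_\gamma(A,B)=\sum_{x\in A,y\in B}\Theta_\gamma(x,y)$ (with singletons written without braces): (a) $\Theta_\Gamma(x,G)=1$ for $\mu$-almost-all $\Gamma$ and all $x\in G$; (b) $\Theta_{g\gamma}(gx,gy)=\Theta_\gamma(x,y)$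 for all $\gamma$ and all $x,y,g\in G$. A transport rule is balanced if in addition $\Theta_\Gamma(G,y)=p^{-1}\Gamma(y)$ for $\mu$-almost-all $\Gamma$ and all $y\in G$. *)

(* Defs.v *)
From HB Require Import structures.
From mathcomp Require Import all_boot all_order all_algebra.
From mathcomp Require Import all_classical all_reals all_analysis.

Set Implicit Arguments.
Unset Strict Implicit.
Unset Printing Implicit Defensive.
Import Order.TTheory GRing.Theory Num.Theory.
Import numFieldNormedType.Exports.

Local Open Scope classical_set_scope.
Local Open Scope ring_scope.

Definition cylinders (G : groupType) : set (set (G -> bool)) :=
  \bigcup_(x in [set: G])
    preimage_set_system [set: G -> bool] (fun gamma => gamma x) measurable.
Arguments cylinders : clear implicits.

(* {0,1}^G with the product sigma-algebra; gamma x = true encodes the value 1 *)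
Notation config G := (g_sigma_algebraType (cylinders G)).

Definition act (G : groupType) (g : G) (gamma : config G) : config G :=
  fun x => gamma (g^-1 * x)%g.

Section ExtraHead.
Context (R : realType) (G : groupType).
Implicit Types (mu : probability (config G) R).

Definition invariant_measure mu : Prop :=
  forall (g : G) (A : set (config G)), measurable A ->
    mu (act g @^-1` A) = mu A.

Definition ergodic_measure mu : Prop :=
  forall A : set (config G), measurable A ->
    (forall g : G, act g @^-1` A = A) -> mu A = 0%E \/ mu A = 1%E.

Definition head_at (x : G) : set (config G) := [set gamma | gamma x = true].

Definition intensity mu : R := fine (mu (head_at 1%g)).

Definition conditioned_on_head mu : set (config G) -> \bar R :=
  fun A => (mu (A `&` head_at 1%g) / mu (head_at 1%g))%E.

Definition mass (theta : config G -> G -> G -> R) (gamma : config G)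
    (A B : set G) : \bar R :=
  \esum_(xy in A `*` B) (theta gamma xy.1 xy.2)%:E.

(* Being defined only mu-almost everywhere is modelled by a measurable domain of
   full measure; values of tr_fun outside it are irrelevant. The domain is not
   required to be invariant: equivariance is imposed whenever both sides are
   defined. As G is countable and discrete, measurability for each pair (x, y)
   is joint measurability. *)
Record transport_rule mu := TransportRule {
  tr_dom : set (config G);
  tr_fun :> config G -> G -> G -> R;
  tr_dom_measurable : measurable tr_dom;
  tr_dom_full : mu (~` tr_dom) = 0%E;
  tr_measurable : forall x y : G,
    measurable_fun tr_dom (fun gamma => tr_fun gamma x y);
  tr_ge0 : forall (gamma : config G) (x y : G),
    tr_dom gamma -> 0 <= tr_fun gamma x y;
  tr_out : {ae mu, forall gamma, tr_dom gamma ->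
    forall x : G, mass tr_fun gamma [set x] [set: G] = 1%E};
  tr_equivariant : forall (gamma : config G) (x y g : G),
    tr_dom gamma -> tr_dom (act g gamma) ->
    tr_fun (act g gamma) (g * x)%g (g * y)%g = tr_fun gamma x y
}.

Definition balanced mu (Theta : transport_rule mu) : Prop :=
  {ae mu, forall gamma, tr_dom Theta gamma -> forall y : G,
    mass Theta gamma [set: G] [set y] =
      ((intensity mu)^-1 * (gamma y)%:R)%:E}.

Definition has_law d d' (T : measurableType d) (S : measurableType d')
    (P : probability T R) (Y : T -> S) (nu : set S -> \bar R) : Prop :=
  forall A : set S, measurable A -> pushforward P Y A = nu A.

(* Z is a version of P(E | Y), the conditional probability given sigma(Y). *)
Definition is_cond_prob d d' (T : measurableType d) (S : measurableType d')
    (P : probability T R) (Y : {RV P >-> S}) (E : set T) (Z : T -> R) : Prop :=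
  [/\ measurable_fun [set: g_sigma_algebra_preimageType Y]
        (Z : g_sigma_algebra_preimageType Y -> R),
      P.-integrable [set: T] (EFin \o Z) &
      forall A : set T, g_sigma_algebra_preimage Y A ->
        (\int[P]_(w in A) (Z w)%:E)%E = P (E `&` A)].

Definition extra_head_scheme mu d (T : measurableType d) (P : probability T R)
    (Gam : {RV P >-> config G}) (X : T -> G) : Prop :=
  has_law P (fun w => act (X w)^-1%g (Gam w)) (conditioned_on_head mu).

End ExtraHead.

(* Main.v *)
Require Import Defs.
From HB Require Import structures.
From mathcomp Require Import all_boot all_order all_algebra.
From mathcomp Require Import all_classical all_reals all_analysis.
From mathcomp Require Import measurable_realfun.
Import Order.TTheory GRing.Theory Num.Theory.
Import numFieldNormedType.Exports.
Local Open Scope classical_set_scope.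
Local Open Scope ring_scope.

(** The law of the shifted configuration X^-1 Gamma has a density with respect
to mu, namely the mass that the site 1 receives under Theta. For a measurable
set A, decompose according to the value x of X:

  P(X^-1 Gamma in A) = sum_x P(X = x, x^-1 Gamma in A)
                     = sum_x int_{x^-1 gamma in A} Theta_gamma(1, x) dmu
                     = sum_x int_A Theta_gamma(x^-1, 1) dmu
                     = int_A Theta_gamma(G, 1) dmu.

The second equality is the hypothesis on conditional probabilities, the third
is the invariance of mu combined with the equivariance of Theta, and the last is
monotone convergence (prob_shift_slice and law_shift). On the other hand, the
conditioned measure mu^* has density p^-1 gamma(1) (integral_head_density).
Hence X is an extra head scheme if and only if the two densities agree almost
everywhere. By invariance of mu and equivariance of Theta, this almost sure
identity at the site 1 holds at every site as soon as it holds at 1, and so is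
equivalent to Theta being balanced (balanced_received).

The transport rule is only controlled on a domain of full measure that need not
be invariant. The argument therefore works on the largest invariant subset of
the domain, which still has full measure, with Theta replaced by 0 outside. *)

Set Implicit Arguments.
Unset Strict Implicit.
Unset Printing Implicit Defensive.

(** * Preliminaries *)

(** Change of variables along a map with a given law. *)
Lemma integral_has_law (R : realType) d d' (T : measurableType d)
    (S : measurableType d') (P : probability T R) (nu : probability S R)
    (Y : T -> S) (B : set S) (f : S -> \bar R) :
  measurable_fun [set: T] Y -> has_law P Y nu -> measurable B ->
  measurable_fun [set: S] f -> (forall s, 0 <= f s)%E ->
  (\int[P]_(w in Y @^-1` B) f (Y w) = \int[nu]_(s in B) f s)%E.
Proof.
move=> mY law mB mf f0.
rewrite -(ge0_integral_pushforward mY P mB) //; last exact: measurable_funTS.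
by apply: (eq_measure_integral nu) => // C mC _; exact: law.
Qed.

(** Applied to the group, this enumeration turns sums over sites into series. *)
Lemma bij_nat_countable (T : Type) : countable [set: T] ->
  infinite_set [set: T] -> exists e : nat -> T, set_bij [set: nat] [set: T] e.
Proof.
move=> cT iT; have /card_set_bijP[f [_ injf surjf]] := eq_card_nat cT iT.
have /choice[e fe] : forall n : nat, exists x, f x = n.
  by move=> n; have [x _ <-] := surjf n I; exists x.
exists e; split=> //; first by move=> m n _ _ eq_e; rewrite -(fe m) eq_e fe.
by move=> x _; exists (f x) => //; apply: injf; rewrite ?inE.
Qed.

(** * The action on configurations *)

Section Action.
Context (R : realType) (G : groupType).
Implicit Types (mu : probability (config G) R) (g h : G) (A : set (config G)).

Lemma act1 (gamma : config G) : act 1%g gamma = gamma.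
Proof. by apply/funext => x; rewrite /act invg1 mul1g. Qed.

Lemma actM g h (gamma : config G) : act (g * h)%g gamma = act g (act h gamma).
Proof. by apply/funext => x; rewrite /act invgM mulgA. Qed.

Lemma measurable_act g : measurable_fun [set: config G] (act g).
Proof.
apply: (@measurability _ _ (config G) (config G) setT (act g)
  (cylinders G)) => // _ [_ [x _ [B mB <-]] <-].
rewrite !setTI; apply: sub_sigma_algebra.
by exists (g^-1 * x)%g => //; exists B => //; rewrite setTI.
Qed.

Lemma measurable_act_preimage g A :
  measurable A -> measurable (act g @^-1` A).
Proof.
by move=> mA; rewrite -[X in measurable X]setTI; exact: measurable_act.
Qed.

Lemma measurable_head_at (x : G) : measurable (head_at x : set (config G)).
Proof.
apply: sub_sigma_algebra; exists x => //; exists [set true] => //.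
by rewrite setTI.
Qed.

Lemma integral_act mu g A (f : config G -> \bar R) :
  invariant_measure mu -> measurable A -> measurable_fun [set: config G] f ->
  (forall gamma, 0 <= f gamma)%E ->
  (\int[mu]_(gamma in act g @^-1` A) f (act g gamma) =
   \int[mu]_(gamma in A) f gamma)%E.
Proof.
move=> inv mA mf f0; have law : has_law mu (act g) mu by exact: inv.
exact: (integral_has_law (measurable_act g) law mA mf f0).
Qed.

(** As G is countable, an almost sure property of gamma holds almost surely
for all translates of gamma at once. *)
Lemma ae_forall_act mu (e : nat -> G) (Q : config G -> Prop) :
  invariant_measure mu -> set_surj [set: nat] [set: G] e ->
  {ae mu, forall gamma, Q gamma} ->
  {ae mu, forall gamma, forall g, Q (act g gamma)}.
Proof.
move=> inv se [N [mN N0 QN]].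
apply: (@negligibleS _ _ _ _ (\bigcup_n (act (e n) @^-1` N))).
  move=> gamma /= /existsNP[g nQ].
  have [n _ en] := se g I.
  by exists n => //; rewrite /= en; exact: QN.
apply: negligible_bigcup => n; exists (act (e n) @^-1` N); split => //.
- exact: measurable_act_preimage.
- by rewrite -[RHS]N0; exact: inv.
Qed.

End Action.

(** * Mass received by a site *)

Section Transport.
Context (R : realType) (G : groupType) (mu : probability (config G) R)
  (Theta : transport_rule mu) (countableG : countable [set: G]).

(** The configurations all of whose translates lie in the domain of Theta: the
largest invariant subset of the domain. *)
Definition tr_core : set (config G) :=
  \bigcap_(g in [set: G]) act g @^-1` tr_dom Theta.

(** Theta on the core, extended by 0: a nonnegative, measurable and exactly
equivariant function of all configurations. *)
Definition tr_ext (x y : G) (gamma : config G) : \bar R :=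
  ((fun gamma : config G => (Theta gamma x y)%:E) \_ tr_core) gamma.

(** The total mass sent to y, Theta_gamma(G, y), computed with the extension of
Theta by 0; it may be infinite. *)
Definition received (y : G) (gamma : config G) : \bar R :=
  \esum_(x in [set: G]) tr_ext x y gamma.

Lemma tr_core_dom : tr_core `<=` tr_dom Theta.
Proof. by move=> gamma /(_ 1%g I); rewrite /= act1. Qed.

Lemma tr_core_act g gamma : tr_core (act g gamma) <-> tr_core gamma.
Proof.
split=> H h _ /=; last by rewrite -actM; exact: H.
by have := H (h * g^-1)%g I; rewrite /= -actM mulgVK.
Qed.

Lemma measurable_tr_core : measurable tr_core.
Proof.
rewrite -[X in measurable X]setCK /tr_core setC_bigcap; apply: measurableC.
apply: countable_bigcupT_measurable => // g; apply: measurableC.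
by apply: measurable_act_preimage; exact: tr_dom_measurable.
Qed.

Lemma ae_tr_core (e : nat -> G) : invariant_measure mu ->
  set_surj [set: nat] [set: G] e -> {ae mu, forall gamma, tr_core gamma}.
Proof.
move=> inv se; have : {ae mu, forall gamma, tr_dom Theta gamma}.
  exists (~` tr_dom Theta); split => //.
  - by apply: measurableC; exact: tr_dom_measurable.
  - exact: tr_dom_full.
move=> /(ae_forall_act inv se); apply: filterS => gamma H g _.
exact: H.
Qed.

Lemma tr_ext_core x y gamma :
  tr_core gamma -> tr_ext x y gamma = (Theta gamma x y)%:E.
Proof. by move=> cg; rewrite /tr_ext patchE mem_set. Qed.

Lemma tr_ext_ge0 x y gamma : (0 <= tr_ext x y gamma)%E.
Proof.
rewrite /tr_ext patchE; case: ifPn => // /set_mem cg.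
by rewrite lee_fin tr_ge0 //; exact: tr_core_dom.
Qed.

Lemma measurable_tr_ext x y : measurable_fun [set: config G] (tr_ext x y).
Proof.
apply/(measurable_restrictT _ measurable_tr_core)/measurable_EFinP.
exact: (measurable_funS (tr_dom_measurable Theta) tr_core_dom
  (@tr_measurable _ _ _ Theta x y)).
Qed.

Lemma tr_ext_act g x y gamma :
  tr_ext (g * x)%g (g * y)%g (act g gamma) = tr_ext x y gamma.
Proof.
have [cg|ncg] := pselect (tr_core gamma).
  have cgg : tr_core (act g gamma) by exact/tr_core_act.
  by rewrite !tr_ext_core // tr_equivariant //; exact: tr_core_dom.
rewrite /tr_ext !patchE !memNset // => /tr_core_act; exact: ncg.
Qed.

Lemma received_act g y gamma :
  received (g * y)%g (act g gamma) = received y gamma.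
Proof.
rewrite /received (reindex_esum [set: G] [set: G] (fun x => g * x)%g).
  by apply: eq_esum => x _; rewrite tr_ext_act.
split=> //; first by move=> x y' _ _ /mulgI.
by move=> x _; exists (g^-1 * x)%g => //=; rewrite mulVKg.
Qed.

Lemma mass_received y gamma : tr_core gamma ->
  mass Theta gamma [set: G] [set y] = received y gamma.
Proof.
move=> cg; rewrite /mass /received.
rewrite (reindex_esum [set: G] ([set: G] `*` [set y]) (fun x => (x, y))) //=.
  by apply: eq_esum => x _; rewrite tr_ext_core.
split=> //; first by move=> x x' _ _ [].
by move=> [x z] [_ /= ->]; exists x.
Qed.

(** The sites are enumerated by the inverses of the e n, since the event
X = e n contributes the mass sent from (e n)^-1 to 1. *)
Lemma received1_nneseries (e : nat -> G) gamma :
  set_bij [set: nat] [set: G] e ->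
  received 1%g gamma = (\sum_(0 <= n <oo) tr_ext (e n)^-1%g 1%g gamma)%E.
Proof.
move=> be; rewrite nneseries_esumT => [|n]; last exact: tr_ext_ge0.
rewrite -(reindex_esum [set: nat] [set: G] e
  (fun x => tr_ext x^-1%g 1%g gamma)) //.
apply: (reindex_esum [set: G] [set: G] (fun x => x^-1)%g).
split=> //; first by move=> x y _ _ /invg_inj.
by move=> x _; exists x^-1%g => //=; rewrite invgK.
Qed.

Lemma measurable_received1 (e : nat -> G) :
  set_bij [set: nat] [set: G] e ->
  measurable_fun [set: config G] (received 1%g).
Proof.
move=> be.
rewrite (_ : received 1%g = fun gamma =>
    (\sum_(0 <= n <oo | n \in xpredT) tr_ext (e n)^-1%g 1%g gamma)%E).
  apply: ge0_emeasurable_sum => [n gamma _ _|n _]; first exact: tr_ext_ge0.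
  exact: measurable_tr_ext.
by apply/funext => gamma; exact: received1_nneseries.
Qed.

(** Being balanced need only be tested at the site 1. *)
Lemma balanced_received (e : nat -> G) :
  invariant_measure mu -> set_surj [set: nat] [set: G] e ->
  balanced Theta <-> {ae mu, forall gamma,
    received 1%g gamma = ((intensity mu)^-1 * (gamma 1%g)%:R)%:E}.
Proof.
move=> inv se; have core := ae_tr_core inv se; split.
  apply: (filterS2 _ _ core) => gamma cg /(_ (tr_core_dom cg) 1%g) <-.
  by rewrite mass_received.
move=> /(ae_forall_act inv se); apply: (filterS2 _ _ core) => gamma cg H _ y.
rewrite mass_received //.
have -> : received y gamma = received 1%g (act y^-1%g gamma).
  by rewrite -[in RHS](received_act y) mulg1 -actM mulgV act1.
by rewrite H /act invgK mulg1.
Qed.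

End Transport.

(** * The law of the shifted configuration *)

Section Shift.
Context (R : realType) (G : groupType) (mu : probability (config G) R)
  (Theta : transport_rule mu) (countableG : countable [set: G])
  (inv : invariant_measure mu) (e : nat -> G)
  (bij_e : set_bij [set: nat] [set: G] e)
  (d : measure_display) (Omega : measurableType d) (P : probability Omega R)
  (Gam : {RV P >-> config G}) (Gam_law : has_law P Gam mu)
  (X : Omega -> G) (X_measurable : forall B : set G, measurable (X @^-1` B))
  (Z : G -> Omega -> R)
  (condZ : forall x : G, is_cond_prob Gam (X @^-1` [set x]) (Z x))
  (Theta_Z : {ae P, forall w, tr_dom Theta (Gam w) ->
     forall x : G, Theta (Gam w) 1%g x = Z x w}).
Implicit Types A : set (config G).

Lemma measurable_rv_preimage A : measurable A -> measurable (Gam @^-1` A).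
Proof.
by move=> mA; rewrite -[X in measurable X]setTI; exact: measurable_funPT.
Qed.

(** The event X = x contributes the mass that the site 1 receives from x^-1. *)
Lemma prob_shift_slice x A : measurable A ->
  (P (X @^-1` [set x] `&` Gam @^-1` (act x^-1%g @^-1` A)) =
   \int[mu]_(gamma in A) tr_ext Theta x^-1%g 1%g gamma)%E.
Proof.
have [_ _ surj_e] := bij_e.
move=> mA; set B := act x^-1%g @^-1` A.
have mB : measurable B by exact: measurable_act_preimage.
have [_ intZ <-] := condZ x; last by exists B => //; rewrite setTI.
(* Almost surely, Gamma lies in the core and Z x is Theta_Gamma(1, x). *)
have -> : (\int[P]_(w in Gam @^-1` B) (Z x w)%:E =
           \int[P]_(w in Gam @^-1` B) tr_ext Theta 1%g x (Gam w))%E.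
  apply: ae_eq_integral.
  - exact: measurable_rv_preimage.
  - exact/measurable_funTS/(measurable_int P intZ).
  - apply: measurable_funTS.
    exact: (measurableT_comp (measurable_tr_ext Theta countableG 1%g x)).
  - have [N [mN N0 coreN]] := ae_tr_core Theta inv surj_e.
    have core_Gam : {ae P, forall w, tr_core Theta (Gam w)}.
      exists (Gam @^-1` N); split.
      + exact: measurable_rv_preimage.
      + by rewrite -[RHS]N0; exact: Gam_law.
      + by move=> w /coreN.
    apply: (filterS2 _ _ Theta_Z core_Gam) => w ThZ cw _.
    by rewrite tr_ext_core // ThZ //; exact: tr_core_dom.
(* Pass to an integral against mu, then substitute gamma := x gamma. *)
rewrite (integral_has_law _ Gam_law mB) //.
- rewrite -(integral_act x^-1%g inv mA) //.
  + apply: eq_integral => gamma _.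
    by rewrite -(tr_ext_act Theta x^-1%g 1%g x gamma) mulg1 mulVg.
  + exact: measurable_tr_ext.
  + by move=> gamma; exact: tr_ext_ge0.
- exact: measurable_tr_ext.
- by move=> gamma; exact: tr_ext_ge0.
Qed.

(** The law of X^-1 Gamma has density Theta_gamma(G, 1) with respect to mu. *)
Lemma law_shift A : measurable A ->
  (pushforward P (fun w => act (X w)^-1%g (Gam w)) A =
   \int[mu]_(gamma in A) received Theta 1%g gamma)%E.
Proof.
move=> mA.
have [_ inj_e surj_e] := bij_e.
pose F n := X @^-1` [set e n] `&` Gam @^-1` (act (e n)^-1%g @^-1` A).
have mF n : measurable (F n).
  apply: measurableI; first exact: X_measurable.
  by apply: measurable_rv_preimage; exact: measurable_act_preimage.
have -> : pushforward P (fun w => act (X w)^-1%g (Gam w)) A =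
    P (\bigcup_n F n).
  rewrite /pushforward; congr (P _); apply/seteqP; split=> w /=.
    move=> Aw; have [n _ en] := surj_e (X w) I.
    by exists n => //; split; rewrite //= en.
  by move=> [n _ [/= -> ]].
rewrite measure_bigcup => [|//|]; last first.
  move=> i j _ _ [w [[/= Xi _] [/= Xj _]]].
  by apply: inj_e; rewrite ?inE // -Xi -Xj.
under eq_integral do rewrite (received1_nneseries Theta _ bij_e).
rewrite integral_nneseries //.
- rewrite (@eq_eseriesl _ _ xpredT) => [|n]; last by rewrite in_setT.
  by apply: eq_eseriesr => n _; exact: prob_shift_slice.
- by move=> n; apply: measurable_funTS; exact: measurable_tr_ext.
- by move=> n gamma _; exact: tr_ext_ge0.
Qed.

End Shift.

(** * The density of the conditioned measure *)

Section HeadDensity.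
Context (R : realType) (G : groupType) (mu : probability (config G) R)
  (p_gt0 : 0 < intensity mu).
Implicit Types A : set (config G).

(** The density p^-1 gamma(1) of mu^* with respect to mu. *)
Definition head_density (gamma : config G) : \bar R :=
  ((intensity mu)^-1 * (gamma 1%g)%:R)%:E.

Lemma head_densityE gamma :
  head_density gamma = ((intensity mu)^-1%:E * (\1_(head_at 1%g) gamma)%:E)%E.
Proof.
rewrite /head_density EFinM; congr (_ * (_%:R)%:E)%E.
case E : (gamma 1%g); first by rewrite mem_set.
by rewrite memNset // /head_at /= E.
Qed.

Lemma integrable_head_density : mu.-integrable [set: config G] head_density.
Proof.
rewrite (_ : head_density = fun gamma =>
    ((intensity mu)^-1%:E * (\1_(head_at 1%g) gamma)%:E)%E); last first.
  by apply/funext => gamma; exact: head_densityE.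
apply: integrableZl => //; apply: integrable_indic; exact: measurable_head_at.
Qed.

Lemma integral_head_density A : measurable A ->
  (\int[mu]_(gamma in A) head_density gamma = conditioned_on_head mu A)%E.
Proof.
move=> mA; under eq_integral do rewrite head_densityE.
have mH := measurable_head_at (1%g : G).
rewrite ge0_integralZl //; last first.
- by rewrite lee_fin invr_ge0 ltW.
- apply/measurable_EFinP; exact: measurable_indic.
rewrite integral_indic // /conditioned_on_head setIC muleC; congr (_ * _)%E.
rewrite -[mu (head_at 1%g)]fineK ?fin_num_measure // -/(intensity mu).
by rewrite inver gt_eqF.
Qed.

End HeadDensity.

(** * Extra head schemes and balanced transport rules *)

Unset Implicit Arguments.

Theorem theorem10 (R : realType) (G : groupType)
    (G_infinite : infinite_set [set: G]) (G_countable : countable [set: G])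
    (mu : probability (config G) R)
    (mu_invariant : invariant_measure mu) (mu_ergodic : ergodic_measure mu)
    (p01 : 0 < intensity mu < 1)
    (Theta : transport_rule mu)
    (d : measure_display) (Omega : measurableType d) (P : probability Omega R)
    (Gam : {RV P >-> config G}) (Gam_law : has_law P Gam mu)
    (X : Omega -> G) (X_measurable : forall B : set G, measurable (X @^-1` B))
    (X_Theta : exists Z : G -> Omega -> R,
      (forall x : G, is_cond_prob Gam (X @^-1` [set x]) (Z x)) /\
      {ae P, forall w, tr_dom Theta (Gam w) ->
        forall x : G, Theta (Gam w) 1%g x = Z x w}) :
  extra_head_scheme mu Gam X <-> balanced Theta.
Proof.
have /andP[p_gt0 _] := p01.
have [Z [condZ Theta_Z]] := X_Theta.
have [e bij_e] := bij_nat_countable G_countable G_infinite.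
have [_ _ surj_e] := bij_e.
have law A : measurable A ->
    (pushforward P (fun w => act (X w)^-1%g (Gam w)) A =
     \int[mu]_(gamma in A) received Theta 1%g gamma)%E.
  exact: (law_shift G_countable mu_invariant bij_e Gam_law X_measurable
            condZ Theta_Z).
rewrite (balanced_received Theta mu_invariant surj_e); split.
- move=> ehs.
  have : ae_eq mu setT (head_density mu) (received Theta 1%g).
    apply: integral_ae_eq => //.
    + exact: integrable_head_density.
    + exact: (measurable_received1 Theta G_countable bij_e).
    + move=> E _ mE; rewrite integral_head_density // -law //.
      by rewrite ehs.
  by apply: filterS => gamma /(_ I) <-.
- move=> ae_density A mA; rewrite law // -integral_head_density //.
  apply: ae_eq_integral => //.
  + apply: measurable_funTS.
    exact: (measurable_received1 Theta G_countable bij_e).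
  + apply: measurable_funTS.
    exact: (measurable_int mu (integrable_head_density mu)).
  + by apply: filterS ae_density => gamma Hg _.
Qed.
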